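(* Let $\beta>0$ and, for $k\in\mathbb Z$, let $$\omega_k=\sqrt{\frac{k\tanh(\beta k)}{\beta}},\qquad m_\beta(k)=\frac{\tanh(\beta k)}{\beta},\qquad A(k)=\begin{pmatrix}0&-im_\beta(k)\\-ik&0\end{pmatrix}.$$ Then: (i) $\omega_0=0$ and $A(0)=0$. (ii) For every $k\ne0$, $\omega_k>0$, and $\pm i\omega_k$ are simple eigenvalues of $A(k)$. (iii) $\omega_{-k}=\omega_k$ for every $k\in\mathbb Z$. (iv) The positive frequencies are strictly increasing: $0<\omega_1<\omega_2<\cdots$. (v) $\omega_k\sim\frac1{\sqrt\beta}|k|^{1/2}$ as $|k|\to\infty$, i.e. the ratio of the two sides tends to $1$.
   Context: $A(k)$ is the $2\times2$ complex matrix by which the operator $(h,u)\mapsto(T_\beta u,-h_x)$ acts on the $k$-th Fourier coefficients $(\widehat h(k),\widehat u(k))^\top$ of functions on $\mathbb T=\mathbb R/(2\pi\mathbb Z)$, where $\widehat{T_\beta u}(k)=-im_\beta(k)\widehat u(k)$. All objects in the claim are defined there. *)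

(* Defs.v *)
From HB Require Import structures.
From mathcomp Require Import all_boot all_order all_algebra.
From mathcomp Require Import complex.
From mathcomp Require Import all_classical all_reals all_analysis.

Set Implicit Arguments.
Unset Strict Implicit.
Unset Printing Implicit Defensive.

Import Order.TTheory GRing.Theory Num.Theory.
Import numFieldNormedType.Exports.

Local Open Scope classical_set_scope.
Local Open Scope ring_scope.
Local Open Scope complex_scope.

Definition sinh (R : realType) (x : R) : R := (expR x - expR (- x)) / 2.
Definition cosh (R : realType) (x : R) : R := (expR x + expR (- x)) / 2.
Definition tanh (R : realType) (x : R) : R := sinh x / cosh x.

Definition omega (R : realType) (beta : R) (k : int) : R :=
  Num.sqrt (k%:~R * tanh (beta * k%:~R) / beta).

Definition m_ (R : realType) (beta : R) (k : int) : R :=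
  tanh (beta * k%:~R) / beta.

Definition A (R : realType) (beta : R) (k : int) : 'M[R[i]]_2 :=
  \matrix_(p, q) (nth [::]
    [:: [:: 0;                  - ('i * (m_ beta k)%:C)];
        [:: - ('i * k%:~R);     0                     ]] p)`_q.

(* [eigenvalue] refers to row eigenvectors; a square matrix and its transpose
   have the same eigenvalues and characteristic polynomial, so the notion is
   the same as for matrices acting on columns. *)
Definition simple_eigenvalue (F : fieldType) (n : nat) (M : 'M[F]_n) (a : F) :
  Prop := eigenvalue M a /\ mup a (char_poly M) = 1%N.

(* The filter of neighbourhoods of infinity in the integers: |k| -> oo. *)
Definition int_infty : set_system int :=
  filter_from [set: nat] (fun N => [set k : int | (N <= `|k|)%N]).

#[global] Instance int_infty_proper : ProperFilter int_infty.
Proof.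
apply: filter_from_proper; last by move=> N _; exists (Posz N) => /=.
apply: filter_from_filter; first by exists 0%N.
move=> M N _ _; exists (maxn M N) => // k /=.
by rewrite geq_max => /andP[].
Qed.

(* Main.v *)
Require Import Defs.
From HB Require Import structures.
From mathcomp Require Import all_boot all_order all_algebra.
From mathcomp Require Import complex.
From mathcomp Require Import all_classical all_reals all_analysis.
From mathcomp Require Import ring lra.

Import Order.TTheory GRing.Theory Num.Theory.
Import numFieldNormedType.Exports.

Local Open Scope classical_set_scope.
Local Open Scope ring_scope.
Local Open Scope complex_scope.

(** The matrix [A k] has zero diagonal, so its characteristic polynomial is
    [X^2 - (- i m(k)) (- i k) = X^2 + m(k) k = X^2 + omega_k^2], whose roots
    are [i omega_k] and [- i omega_k]; they are distinct, hence simple, exactly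
    when [omega_k] is nonzero ([char_poly_A], [simple_eigenvalue_factor]).

    The frequencies are controlled by the formula
    [tanh x = 1 - 2 / (exp (2 x) + 1)] ([tanhE]), which shows that [tanh] is
    increasing, positive for positive [x], at most [1], and tends to [1] with
    the explicit rate [1 - tanh x <= 1 / (1 + x)] for positive [x].  As [tanh]
    is odd, [omega] is even, so that [k] may be replaced by its absolute value
    ([omega_norm]).  Strict monotonicity holds since the radicand is the product
    of [k] with a positive increasing factor.  Finally the ratio in the
    asymptotic equivalence is exactly [sqrt (tanh (beta |k|))] for nonzero [k]
    ([omega_ratio]), which lies between [tanh (beta |k|)] and [1]. *)

(** * The hyperbolic tangent *)

Section Tanh.
Context {R : realType}.
Implicit Types x y : R.

(** In this form [x] occurs only once, so that bounds and monotonicity of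
    [tanh] follow from those of the exponential. *)
Lemma tanhE x : tanh x = 1 - 2 / (expR (2 * x) + 1).
Proof.
have e0 := expR_gt0 x.
rewrite /tanh /sinh /cosh expRN (_ : 2 * x = x + x); last by ring.
rewrite expRD; field.
by rewrite !lt0r_neq0 // addr_gt0 // mulr_gt0.
Qed.

Lemma tanhN x : tanh (- x) = - tanh x.
Proof.
by rewrite /tanh /sinh /cosh opprK [expR (- x) + expR x]addrC -!mulNr opprB.
Qed.

Lemma le_tanh : {homo (@tanh R) : x y / x <= y}.
Proof.
move=> x y xy; rewrite !tanhE lerB// ler_pM2l// lef_pV2 ?posrE ?addr_gt0 ?expR_gt0//.
by rewrite lerD2r ler_expR ler_pM2l.
Qed.

Lemma tanh_gt0 x : 0 < x -> 0 < tanh x.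
Proof.
move=> x0; have e0 := expR_gt0 (2 * x); have := expR_ge1Dx (2 * x).
by move=> ex; rewrite tanhE subr_gt0 ltr_pdivrMr ?addr_gt0//; lra.
Qed.

Lemma tanh_le1 x : tanh x <= 1.
Proof. by rewrite tanhE gerBl divr_ge0// addr_ge0// expR_ge0. Qed.

(** A crude rate, obtained from [1 + 2 x <= exp (2 x)]. *)
Lemma tanh_ge x : 0 < x -> 1 - (1 + x)^-1 <= tanh x.
Proof.
move=> x0; have e0 := expR_gt0 (2 * x); have := expR_ge1Dx (2 * x).
move=> ex; rewrite tanhE lerB// ler_pdivrMr ?addr_gt0//.
by rewrite mulrC ler_pdivlMr ?addr_gt0//; lra.
Qed.

End Tanh.

(** * Simple eigenvalues *)

Lemma simple_eigenvalue_factor {F : fieldType} {n} (M : 'M[F]_n) (a b : F) :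
  char_poly M = ('X - a%:P) * ('X - b%:P) -> a != b -> simple_eigenvalue M a.
Proof.
move=> Mab ab; split.
  by rewrite eigenvalue_root_char Mab rootM root_XsubC eqxx.
rewrite Mab mupMl; last by rewrite root_XsubC.
by rewrite -['X - a%:P]expr1 mup_XsubCX eqxx.
Qed.

Lemma char_poly_diag0 {F : comNzRingType} (M : 'M[F]_2) :
  M 0 0 = 0 -> M 1 1 = 0 -> char_poly M = 'X^2 - (M 0 1 * M 1 0)%:P.
Proof.
move=> M00 M11; rewrite /char_poly (expand_det_row _ 0) !big_ord_recl big_ord0.
rewrite /cofactor !det_mx11 !mxE /=.
have -> : lift ord0 ord0 = 1 :> 'I_2 by apply/val_inj.
have -> : lift 1 0 = 0 :> 'I_2 by apply/val_inj.
rewrite M00 M11 /bump /= polyCM polyC0; ring.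
Qed.

(** * The frequencies *)

Section Frequencies.
Context {R : realType} {beta : R} (beta_gt0 : 0 < beta).

Lemma omegaN (k : int) : omega beta (- k) = omega beta k.
Proof. by rewrite /omega intrN mulrN tanhN mulrNN. Qed.

Lemma omega_norm (k : int) : omega beta `|k| = omega beta k.
Proof. by case: (ger0P k) => // _; rewrite omegaN. Qed.

(** The square root of a negative number is [0] by convention, so the
    positivity, squaring and monotonicity of [omega] rest on this sign. *)
Lemma omega_radicand_gt0 {k : int} :
  0 < k -> 0 < (k%:~R * tanh (beta * k%:~R) / beta : R).
Proof.
by move=> k0; rewrite divr_gt0// mulr_gt0 ?ltr0z// tanh_gt0// mulr_gt0 ?ltr0z.
Qed.

Lemma omega_gt0 {k : int} : k != 0 -> 0 < omega beta k.
Proof.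
by move=> k0; rewrite -omega_norm sqrtr_gt0 omega_radicand_gt0// normr_gt0.
Qed.

Lemma omega0 : omega beta 0 = 0.
Proof. by rewrite /omega !mul0r sqrtr0. Qed.

Lemma sqr_omega (k : int) : omega beta k ^+ 2 = m_ beta k * k%:~R.
Proof.
rewrite /m_ mulrAC [tanh _ * _]mulrC sqr_sqrtr//.
have [->|k0] := eqVneq k 0; first by rewrite !mul0r.
by rewrite ltW// -sqrtr_gt0 omega_gt0.
Qed.

(** The factor [k] grows strictly, so that it is enough for [tanh] to be
    nondecreasing. *)
Lemma omega_increasing {k : int} : 1 <= k -> omega beta k < omega beta (k + 1).
Proof.
move=> k1; have k0 : 0 < k by exact: lt_le_trans k1.
have k10 : 0 < k + 1 by rewrite addr_gt0.
rewrite ltr_sqrt ?omega_radicand_gt0// ltr_pM2r ?invr_gt0//.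
apply: (@lt_le_trans _ _ ((k + 1)%:~R * tanh (beta * k%:~R))).
  by rewrite ltr_pM2r ?ltr_int ?ltrDl// tanh_gt0// mulr_gt0 ?ltr0z.
by rewrite ler_pM2l ?ltr0z// le_tanh// ler_pM2l// ler_int lerDl.
Qed.

(** The factors [|k|] and [beta] of the radicand are exactly those of the
    asymptotic equivalent: only the factor [tanh] remains. *)
Lemma omega_ratio {k : int} : k != 0 ->
  omega beta k / ((Num.sqrt beta)^-1 * Num.sqrt (`|k|%:~R : R)) =
  Num.sqrt (tanh (beta * `|k|%:~R)).
Proof.
move=> k0; have nk0 : 0 < `|k| by rewrite normr_gt0.
have sk0 : Num.sqrt (`|k|%:~R : R) != 0 by rewrite gt_eqF// sqrtr_gt0 ltr0z.
have sb0 : Num.sqrt beta != 0 by rewrite gt_eqF// sqrtr_gt0.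
have nkR0 : 0 <= (`|k|%:~R : R) by rewrite ler0z ltW.
rewrite -omega_norm /omega -mulrA sqrtrM// sqrtrM; last first.
  by rewrite ltW// tanh_gt0// mulr_gt0 ?ltr0z.
by rewrite sqrtrV ?(ltW beta_gt0)//; field; rewrite sk0 sb0.
Qed.

Lemma cvg_omega_ratio :
  (fun k : int =>
      omega beta k / ((Num.sqrt beta)^-1 * Num.sqrt (`|k|%:~R : R)))
     @ int_infty --> (1 : R).
Proof.
apply/cvgrPdist_le => e e0.
(* Beyond this rank, [(1 + beta |k|)^-1 <= (beta |k|)^-1 <= e]; the successor
   excludes [k = 0], at which the ratio has denominator zero. *)
pose N := (Num.bound ((beta * e)^-1)).+1.
exists N => // k /= Nk; have k0 : k != 0 by rewrite -absz_gt0 (leq_trans _ Nk).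
have nk0 : 0 < (`|k|%:~R : R) by rewrite ltr0z normr_gt0.
have x0 : 0 < beta * `|k|%:~R by rewrite mulr_gt0.
have t0 := tanh_gt0 _ x0; have t1 := tanh_le1 (beta * `|k|%:~R).
rewrite omega_ratio//; set t := tanh _ in t0 t1 *.
have s1 : Num.sqrt t <= 1 by rewrite -sqrtr1 ler_sqrt.
(* On the unit interval a number lies below its square root, so that the rate
   of [tanh] is also a rate for its square root. *)
have ts : t <= Num.sqrt t.
  by rewrite -{1}[t]sqr_sqrtr ?(ltW t0)// expr2 ler_piMr// sqrtr_ge0.
rewrite ger0_norm ?subr_ge0// (le_trans (lerB (lexx _) ts))// lerBlDl -lerBlDr.
apply: le_trans (tanh_ge _ x0); rewrite lerB// -[leRHS]invrK.
rewrite lef_pV2 ?posrE ?invr_gt0 ?addr_gt0//.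
have be : (beta * e)^-1 <= `|k|%:~R.
  apply: (le_trans (ltW (archi_boundP _))); first by rewrite invr_ge0 mulr_ge0// ltW.
  by rewrite -abszE -[(_ %:~R)]/((absz k)%:R) ler_nat (leq_trans _ Nk).
move: be; rewrite invfM ler_pdivrMl// => /le_trans; apply.
by rewrite lerDr.
Qed.

Lemma A0 : A beta 0 = 0.
Proof.
apply/matrixP => p q; rewrite !mxE /m_ mulr0 /tanh /sinh oppr0 subrr !mul0r.
by case: p => [[|[|]]]// ?; case: q => [[|[|]]]// ? /=; rewrite ?mulr0 ?oppr0.
Qed.

Lemma char_poly_A (k : int) :
  char_poly (A beta k) = ('X - ('i * (omega beta k)%:C)%:P)
                         * ('X - (- ('i * (omega beta k)%:C))%:P).
Proof.
rewrite char_poly_diag0 ?mxE//= mulrNN.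
suff -> : 'i * (m_ beta k)%:C * ('i * k%:~R) = ('i * (omega beta k)%:C) ^+ 2.
  by rewrite polyCN opprK -subr_sqr polyC_exp.
rewrite [RHS]exprMn -rmorphXn sqr_omega; move: (m_ beta k) => m.
by rewrite rmorphM /= rmorph_int; ring.
Qed.

Lemma A_eigenvalues_neq {k : int} : k != 0 ->
  'i * (omega beta k)%:C != - ('i * (omega beta k)%:C).
Proof.
move=> /omega_gt0 w0; rewrite -subr_eq0 opprK -mulr2n mulrn_eq0 /= mulf_neq0 ?neq0Ci//.
by rewrite (inj_eq (@complexI R) _ 0) gt_eqF.
Qed.

End Frequencies.

Theorem proposition3p1 (R : realType) (beta : R) (beta_gt0 : 0 < beta) :
  (omega beta 0 = 0 /\ A beta 0 = 0) /\
  (forall k : int, k != 0 ->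
     0 < omega beta k /\
     simple_eigenvalue (A beta k) ('i * (omega beta k)%:C) /\
     simple_eigenvalue (A beta k) (- ('i * (omega beta k)%:C))) /\
  (forall k : int, omega beta (- k) = omega beta k) /\
  (0 < omega beta 1 /\
   forall k : int, 1 <= k -> omega beta k < omega beta (k + 1)) /\
  ((fun k : int =>
      omega beta k / ((Num.sqrt beta)^-1 * Num.sqrt (`|k|%:~R : R)))
     @ int_infty --> (1 : R)).
Proof.
split; first by split; [exact: omega0|exact: A0].
split.
  move=> k k0; have neq := A_eigenvalues_neq beta_gt0 k0.
  split; first exact: omega_gt0.
  split; apply: simple_eigenvalue_factor.
  - exact: char_poly_A.
  - exact: neq.
  - by rewrite char_poly_A// mulrC.
  - by rewrite eq_sym.
split; first exact: omegaN.
split; last exact: cvg_omega_ratio.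
by split; [exact: omega_gt0|exact: omega_increasing].
Qed.
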